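(* For $n\ge1$ define \[ \theta(n) = \begin{cases} 1 & \text{if } n = 3^a \text{ with } a \ge 1,\\ -2 & \text{if } n = 2\cdot 3^a \text{ with } a\ge 1,\\ 0 & \text{otherwise.}\end{cases} \] Then the number of $n$-cycles in $S_n$ that avoid the consecutive pattern $\underline{123}$ is \[ \frac{1}{n}\left[\theta(n) + \sum_{\substack{d\mid n\\ d\equiv 1 \bmod 3}} \mathrm{M\ddot{o}b}(d)\,\gamma_{n/d} + \sum_{\substack{d\mid n\\ d\equiv 2\bmod 3}} \mathrm{M\ddot{o}b}(d)\,(-1)^{n/d}\,\gamma^*_{n/d}\right]. \]
   Context: $S_n$ is the symmetric group on $[n]=\{1,\dots,n\}$. An $n$-cycle is a permutation in $S_n$ consisting of a single cycle of length $n$. An ascent (resp. descent) of $\pi\in S_n$ is an index $i\in[n-1]$ with $\pi(i)<\pi(i+1)$ (resp. $\pi(i)>\pi(i+1)$). A permutation avoids the consecutive pattern $\underline{123}$ if it does not have two consecutive ascents, i.e. there is no $i$ with $\pi(i)<\pi(i+1)<\pi(i+2)$; it avoids $\underline{321}$ if it does not have two consecutive descents. $\gamma_n$ is the number of permutations in $S_n$ avoiding $\underline{123}$. For $n\ge2$, $\gamma_n^*$ is the number of permutations in $S_n$ that avoid $\underline{321}$ and begin and end with an ascent (i.e. $\pi(1)<\pi(2)$ and $\pi(n-1)<\pi(n)$); by convention $\gamma_0^*=1$ and $\gamma_1^*=0$. $\mathrm{M\ddot{o}b}$ is the number-theoretic Möbius function; sums over $d$ range over positive divisors. *)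

(* Defs.v *)
From HB Require Import structures.
From mathcomp Require Import all_boot all_order all_algebra all_fingroup.

Set Implicit Arguments.
Unset Strict Implicit.
Unset Printing Implicit Defensive.

Import GRing.Theory.

(* 'S_n permutes {0, ..., n-1} rather than [n], so positions and values are
   shifted by one; an ascent or descent at i compares positions i and i.+1,
   both of which must be < n. *)
Definition ascent (n : nat) (s : 'S_n) (i : nat) : bool :=
  [exists x : 'I_n, exists y : 'I_n,
     [&& val x == i, val y == i.+1 & (s x < s y)%N]].

Definition descent (n : nat) (s : 'S_n) (i : nat) : bool :=
  [exists x : 'I_n, exists y : 'I_n,
     [&& val x == i, val y == i.+1 & (s y < s x)%N]].

Definition avoids_123 (n : nat) (s : 'S_n) : bool :=
  [forall i : 'I_n, ~~ (ascent s i && ascent s i.+1)].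

Definition avoids_321 (n : nat) (s : 'S_n) : bool :=
  [forall i : 'I_n, ~~ (descent s i && descent s i.+1)].

Definition is_full_cycle (n : nat) (s : 'S_n) : bool :=
  porbits s == [set [set: 'I_n]].

Definition gamma (n : nat) : nat := #|[set s : 'S_n | avoids_123 s]|.

Definition gamma_star (n : nat) : nat :=
  match n with
  | 0 => 1
  | 1 => 0
  | m.+2 => #|[set s : 'S_m.+2 |
                 [&& avoids_321 s, ascent s 0 & ascent s m]]|
  end.

(* prime_decomp n lists the pairs (p, e) of the factorisation of n; the value
   at 0 is irrelevant and set to 0. *)
Definition mobius (n : nat) : int :=
  if (0 < n)%N && all (fun f : nat * nat => f.2 == 1) (prime_decomp n)
  then ((-1) ^+ size (prime_decomp n))%R else 0%R.

(* The bound a <= n loses nothing, since a < 3 ^ a. *)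
Definition theta (n : nat) : int :=
  if [exists a : 'I_n.+1, (1 <= a)%N && (n == 3 ^ a)] then 1%R
  else if [exists a : 'I_n.+1, (1 <= a)%N && (n == 2 * 3 ^ a)] then (-2)%R
  else 0%R.

(* Main.v *)
Require Import Defs.
From HB Require Import structures.
From mathcomp Require Import all_boot all_order all_algebra all_fingroup.
From mathcomp Require Import zify ring.
Set Implicit Arguments.
Unset Strict Implicit.
Unset Printing Implicit Defensive.
Import GRing.Theory.
Local Open Scope ring_scope.


(** The count rests on the decomposition of a permutation into its maximal
    increasing runs.  Avoiding two consecutive ascents means that all runs have
    length at most 2; avoiding two consecutive descents while starting and
    ending with an ascent means that all runs have length at least 2; being
    decreasing means that all runs have length 1.  Each of these properties is
    detected, up to sign, by a product of weights [v r] over the run lengths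
    [r].  If [v] and [c] are related by
    sum_r v_r x^r = 1 / (1 - sum_(j > 0) c_j x^j), then expanding every [v r]
    over the compositions of [r] rewrites that product as a sum, over all
    compositions of [n] whose blocks the permutation maps increasingly, of the
    product of the [c j] over the block sizes ([sum_refinements]).

    A composition is encoded by the weakly increasing word [f] that takes the
    value [k] on its [k]-th block.  Pairs made of a composition and a
    permutation increasing on its blocks then correspond to packed words
    (words whose letters form an initial segment), in two ways:
    - standardization sends ([f], [p]) to [f \o p^-1], so that the sum of
      [prod_a c (number of letters a)] over all packed words equals the sum of
      the run weights over all permutations ([sum_packed_runs]);
    - the Gessel-Reutenauer correspondence sends ([f], [p], [x]), with [p] an
      [n]-cycle and [x] a starting point, to the word [f (p^j x)]; it reaches
      exactly the primitive packed words, hence the same sum over primitive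
      words is [n] times the sum over [n]-cycles ([sum_primitive_runs]).
    In both cases the word [w] is [f \o s] for a permutation [s] of positions,
    and [s] is recovered by sorting the positions for a total order determined
    by [w]: letter and then position in the first case, lexicographic order of
    the rotations of [w] in the second.  [sum_packed] is the common argument.

    Every word is a power of a primitive one, and a [d]-th power has the letter
    multiplicities of its root multiplied by [d].  Moebius inversion thus
    expresses the primitive sum through full sums in which [c] is replaced by
    [j |-> c (d * j)] ([sum_primitive_mobius]).  For the weight of [gamma], the
    sequence [c] is -1, 1, 0 according to [j] modulo 3, so [c (d * j)] only
    depends on [d] modulo 3: residue 1 gives [gamma] again, residue 2 gives the
    weight of runs of length at least 2, that is [gamma_star] up to a sign, and residue 0
    gives the weight of the decreasing permutation, whose contribution
    sum_(3 | d | n) mobius(d) (-1)^(n/d) is [theta] ([thetaE]). *)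

(** * Run weights and compositions *)

(** A composition is a bit sequence marking the cuts between consecutive
    positions; [k] is the length of the block being read, so that [runprod v 1 b]
    is the product of [v] over the block sizes of [b]. *)
Fixpoint runprod (R : comNzRingType) (v : nat -> R) (k : nat) (b : seq bool) : R :=
  match b with
  | [::] => v k
  | true :: b' => v k * runprod v 1 b'
  | false :: b' => runprod v k.+1 b'
  end.

(** Refinement of compositions: every cut of [b] is a cut of [D]. *)
Definition bits_le (b D : seq bool) : bool := all2 implb b D.

Lemma sum_tuple_cons (R : zmodType) m (F : seq bool -> R) (P : pred (seq bool)) :
  \sum_(D : m.+1.-tuple bool | P D) F D
  = \sum_(D : m.-tuple bool | P (true :: D)) F (true :: D)
    + \sum_(D : m.-tuple bool | P (false :: D)) F (false :: D).
Proof.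
rewrite (bigID (fun D : m.+1.-tuple bool => thead D)) /=; congr (_ + _).
  rewrite (reindex_onto (fun D : m.-tuple bool => [tuple of true :: D])
             (fun D => [tuple of behead D])) /=.
    by apply: eq_bigl => D; rewrite andbT (_ : _ == D) ?andbT //; apply/eqP/val_inj.
  by move=> D; case/tupleP: D => -[] D /andP[_ //] _; apply: val_inj.
rewrite (reindex_onto (fun D : m.-tuple bool => [tuple of false :: D])
           (fun D => [tuple of behead D])) /=.
  by apply: eq_bigl => D; rewrite andbT (_ : _ == D) ?andbT //; apply/eqP/val_inj.
by move=> D; case/tupleP: D => -[] D /andP[_ //] _; apply: val_inj.
Qed.

Section RunTheorem.

Variables (R : comNzRingType) (c v : nat -> R).

(** The convolution that makes [1 + sum v_r x^r] the inverse of [1 - sum c_j x^j],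
    started at an arbitrary block length [k] to permit induction. *)
Definition run_conv (k r : nat) : R := \sum_(j < r.+1) c (k + j)%N * v (r - j)%N.

Lemma run_convS k r : run_conv k r.+1 = c k * v r.+1 + run_conv k.+1 r.
Proof.
rewrite /run_conv big_ord_recl addn0 subn0; congr (_ + _).
by apply: eq_bigr => j _; rewrite lift0 addnS addSn subSS.
Qed.

(** [runprod v] with the first block weighted by [g] instead, [g] taking the
    number of positions that remain in that block.  Linearity in [g]
    ([first_runD]) is what the induction below needs. *)
Fixpoint first_run (g : nat -> R) (b : seq bool) : R :=
  match b with
  | [::] => g 0%N
  | true :: b' => g 0%N * runprod v 1 b'
  | false :: b' => first_run (g \o succn) b'
  end.

Lemma first_runE k g b : (forall r, g r = v (k + r)%N) -> first_run g b = runprod v k b.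
Proof.
elim: b k g => [|[] b IHb] k g eq_g /=; rewrite ?eq_g ?addn0 //.
by apply: IHb => r /=; rewrite eq_g addnS.
Qed.

Lemma first_runD a g g1 g2 b : (forall r, g r = a * g1 r + g2 r) ->
  first_run g b = a * first_run g1 b + first_run g2 b.
Proof.
elim: b g g1 g2 => [|[] b IHb] g g1 g2 eq_g /=; rewrite ?eq_g //.
  by rewrite mulrDl mulrA.
by apply: IHb => r /=.
Qed.

(** Reading one more uncut position offers a choice for [D]: cut, closing a
    block of weight [c k], or go on with a block of length [k.+1].  This is the
    recursion [run_convS] for the weight of the first block. *)
Lemma sum_refinements_from : v 0 = 1 -> (forall r, v r.+1 = run_conv 1 r) ->
  forall k b,
  \sum_(D : (size b).-tuple bool | bits_le b D) runprod c k D
  = first_run (run_conv k) b.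
Proof.
move=> v0 conv k b; elim: b k => [|x b IHb] k.
  rewrite (big_pred1 [tuple]) /=; first by rewrite /run_conv big_ord1 addn0 v0 mulr1.
  by move=> D; rewrite tuple0 /= eqxx.
have refine1 : \sum_(D : (size b).-tuple bool | bits_le b D) runprod c k (true :: D)
             = c k * runprod v 1 b.
  rewrite /= -mulr_sumr IHb (@first_runE 1) //.
rewrite (sum_tuple_cons _ (runprod c k) (bits_le (x :: b))) /=.
case: x => /=.
  by rewrite big_pred0_eq addr0 refine1 /run_conv big_ord1 addn0 v0 mulr1.
rewrite refine1 IHb [RHS](@first_runD (c k) _ (fun r => v r.+1) (run_conv k.+1)).
  by rewrite (@first_runE 1 (fun r => v r.+1)).
exact: run_convS.
Qed.

(** A composition finer than [b] cuts each block of [b] independently, and [v r]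
    is the total [c]-weight of the compositions of [r]. *)
Lemma sum_refinements b : v 0 = 1 -> (forall r, v r.+1 = run_conv 1 r) ->
  \sum_(D : (size b).-tuple bool | bits_le b D) runprod c 1 D = runprod v 1 b.
Proof.
move=> v0 conv; rewrite sum_refinements_from //.
by apply: first_runE => r; rewrite -conv.
Qed.

End RunTheorem.

(** * Packed words and their sorted rearrangements *)

(** The index of the block that contains position [i]. *)
Definition height (D : seq bool) (i : nat) : nat := count id (take i D).

Lemma heightS D i : (i < size D)%N -> height D i.+1 = (height D i + nth false D i)%N.
Proof.
by move=> i_lt; rewrite /height (take_nth false) // -cats1 count_cat /= addn0.
Qed.

Lemma height_le D i : (height D i <= size D)%N.
Proof. by rewrite (leq_trans (count_size _ _)) // size_take_min geq_minr. Qed.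

Lemma height_mono D i j : (i <= j <= size D)%N -> (height D i <= height D j)%N.
Proof.
case/andP; elim: j => [|j IHj]; first by rewrite leqn0 => /eqP->.
rewrite leq_eqVlt => /predU1P[->//|ij j_lt].
by rewrite heightS // (leq_trans (IHj _ (ltnW j_lt))) ?leq_addr.
Qed.

Lemma height_onto D i a : (i <= size D)%N -> (a <= height D i)%N ->
  exists2 j, (j <= i)%N & height D j = a.
Proof.
elim: i => [|i IHi] i_le a_le.
  by exists 0; move: a_le; rewrite // /height take0 /= leqn0 => /eqP->.
have [a_le'|a_gt] := leqP a (height D i).
  by have [j j_le <-] := IHi (ltnW i_le) a_le'; exists j => //; apply: leqW.
exists i.+1 => //; apply/eqP; rewrite eqn_leq a_le andbT heightS //.
by case: nth; rewrite /= ?addn1 ?addn0 // ltnW.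
Qed.

(** The alphabet size [N.+1] is independent of the length, so that words of
    different lengths can share an alphabet when one is a power of the other. *)
Definition word m N := {ffun 'I_m.+1 -> 'I_N.+1}.

Definition packed m N (w : word m N) : bool :=
  [forall i, forall a : 'I_N.+1, (a < w i)%N ==> [exists j, w j == a]].

(** Letters that do not occur contribute [c 0], taken to be 1 below. *)
Definition weight (R : comNzRingType) (c : nat -> R) m N (w : word m N) : R :=
  \prod_(a < N.+1) c #|[set i | w i == a]|.

Definition wperm m N (w : word m N) (s : 'S_m.+1) : word m N := [ffun i => w (s i)].

Lemma wpermE m N (w : word m N) s i : wperm w s i = w (s i).
Proof. exact: ffunE. Qed.

(** The sorted packed word of the composition [D]. *)
Definition stair m N (D : seq bool) : word m N := [ffun i : 'I__ => inord (height D i)].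

Lemma weight_wperm (R : comNzRingType) (c : nat -> R) m N (w : word m N) s :
  weight c (wperm w s) = weight c w.
Proof.
apply: eq_bigr => a _; congr c.
rewrite -[LHS](card_imset _ (@perm_inj _ s)); apply: eq_card => i.
rewrite inE; apply/imsetP/idP => [[j] | wi].
  by rewrite inE ffunE => wsj ->.
by exists (s^-1 i)%g; rewrite ?inE ?ffunE permKV.
Qed.

Lemma val_stair m N (D : m.-tuple bool) (i : 'I_m.+1) : (m <= N)%N ->
  stair m N D i = height D i :> nat.
Proof.
move=> mN; rewrite ffunE inordK // ltnS.
by rewrite (leq_trans (height_le _ _)) // size_tuple.
Qed.

(** The successive letters of the stair word of [D] with first letter [a], in a
    form that follows the recursion of [runprod]. *)
Fixpoint letters (a : nat) (D : seq bool) : seq nat :=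
  a :: if D is x :: D' then letters (a + x) D' else [::].

Lemma size_letters a D : size (letters a D) = (size D).+1.
Proof. by elim: D a => //= x D IHD a; rewrite IHD. Qed.

Lemma nth_letters a D i : (i <= size D)%N -> nth 0%N (letters a D) i = (a + height D i)%N.
Proof.
elim: D a i => [|x D IHD] a [|i] //= i_le; rewrite ?addn0 //.
by rewrite IHD // addnA.
Qed.

Lemma count_letters_lt a D x : (x < a)%N -> count_mem x (letters a D) = 0%N.
Proof.
elim: D a => [|y D IHD] a xa /=; rewrite gtn_eqF ?addn0 //.
by rewrite IHD // (leq_trans xa) // leq_addr.
Qed.

(** The term [(x == a) * k] accounts for the [k] letters of the current block that
    were read before [D]. *)
Lemma runprod_letters (R : comNzRingType) (c : nat -> R) k D a M :
    c 0 = 1 -> (a + size D < M)%N ->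
  runprod c k.+1 D = \prod_(a <= x < M) c ((x == a) * k + count_mem x (letters a D))%N.
Proof.
move=> c0; elim: D a k => [|x D IHD] a k /=.
  rewrite addn0 => aM; rewrite big_ltn // big1_seq ?mulr1.
    by rewrite eqxx mul1n addn0 addn1.
  move=> x; rewrite mem_index_iota => /andP[_ /andP[ax _]].
  by rewrite [x == a]gtn_eqF // [a == x]ltn_eqF.
rewrite addnS => aM.
case: x; rewrite /= ?addn0 ?[(a + true)%N]addn1.
  rewrite big_ltn; last by rewrite (leq_trans _ aM) // ltnS -addnS leq_addr.
  rewrite !eqxx count_letters_lt //= addn0 mul1n addn1; congr (_ * _).
  rewrite (IHD a.+1) ?addSn //; apply: eq_big_nat => x /andP[ax _].
  by rewrite muln0 [x == a]gtn_eqF // [a == x]ltn_eqF.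
rewrite (IHD a) ?(ltnW aM) //; apply: eq_bigr => x _.
congr c; rewrite [a == x]eq_sym; set z := count_mem _ _.
by case: (x == a); rewrite ?mul1n ?mul0n //= add1n addnS addSn.
Qed.

Lemma weight_stair (R : comNzRingType) (c : nat -> R) m N (D : m.-tuple bool) :
  c 0 = 1 -> (m <= N)%N -> weight c (stair m N D) = runprod c 1 D.
Proof.
move=> c0 mN; rewrite (@runprod_letters _ _ _ _ 0 N.+1) ?size_tuple //.
rewrite big_mkord; apply: eq_bigr => a _; rewrite muln0 add0n; congr c.
have -> : letters 0 D = [seq val (stair m N D i) | i <- enum 'I_m.+1].
  apply: (@eq_from_nth _ 0%N); first by rewrite size_letters size_map size_enum_ord size_tuple.
  move=> i; rewrite size_letters size_tuple => i_lt.
  rewrite nth_letters ?size_tuple // (nth_map ord0) ?size_enum_ord //=.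
  by rewrite val_stair // nth_enum_ord.
rewrite -sum1_count big_map big_enum_cond -sum1_card; apply: eq_bigl => i.
by rewrite inE /= -val_eqE.
Qed.

Lemma packed_stair m N (D : m.-tuple bool) (s : 'S_m.+1) : (m <= N)%N ->
  packed (wperm (stair m N D) s).
Proof.
move=> mN; apply/'forall_forallP => i a; apply/implyP.
rewrite ffunE val_stair // => /ltnW a_lt.
have [] := height_onto _ a_lt; first by rewrite size_tuple -ltnS.
move=> j j_le ht_j; apply/existsP; exists ((s^-1)%g (inord j)).
rewrite ffunE permKV -val_eqE /= val_stair // inordK ?ht_j //.
by rewrite (leq_ltn_trans j_le).
Qed.

(** The cuts of the composition obtained by reading [w] in the order given by [s]. *)
Definition jumps m N (w : word m N) (s : 'S_m.+1) : m.-tuple bool :=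
  [tuple (w ((s^-1)%g (inord k)) < w ((s^-1)%g (inord k.+1)))%N | k < m].

Lemma nth_jumps m N (w : word m N) s k : (k < m)%N ->
  nth false (jumps w s) k = (w ((s^-1)%g (inord k)) < w ((s^-1)%g (inord k.+1)))%N.
Proof.
move=> k_lt; rewrite -[k]/(val (Ordinal k_lt)) -tnth_nth.
by rewrite tnth_map tnth_ord_tuple.
Qed.

(** A packed word read in increasing order of its letters starts at 0 and never
    skips a letter, since a skipped letter would have to occur somewhere in
    between.  It is therefore the stair word of its own jumps. *)
Lemma packed_factor m N (w : word m N) (s : 'S_m.+1) : (m <= N)%N -> packed w ->
  (forall i j, (s i < s j)%N -> (w i <= w j)%N) ->
  wperm (stair m N (jumps w s)) s = w.
Proof.
move=> mN /'forall_forallP pk mono.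
pose u k : nat := w ((s^-1)%g (inord k)).
have us i : u (s i) = w i by rewrite /u inord_val permK.
have u_mono k l : (k <= l <= m)%N -> (u k <= u l)%N.
  case/andP; rewrite leq_eqVlt => /predU1P[->//|kl lm]; apply: mono.
  by rewrite !permKV !inordK // (ltn_trans kl).
have s_le i : (s i <= m)%N by rewrite -ltnS.
have uP k : (k <= m)%N -> u k = height (jumps w s) k.
  elim: k => [_|k IHk k_lt].
    rewrite /height take0 /=; apply/eqP; rewrite -leqn0 leqNgt; apply/negP=> u_gt0.
    have /existsP[j /eqP wj] := implyP (pk ((s^-1)%g (inord 0)) ord0) u_gt0.
    have := u_mono 0%N (s j); rewrite us wj s_le => /(_ isT).
    by rewrite leqNgt u_gt0.
  rewrite heightS ?size_tuple // -IHk ?(ltnW k_lt) // nth_jumps //.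
  rewrite -/(u k) -/(u k.+1).
  have : (u k <= u k.+1)%N by apply: u_mono; rewrite leqnSn.
  rewrite leq_eqVlt => /predU1P[->|lt_u]; first by rewrite ltnn addn0.
  rewrite lt_u addn1; apply/eqP; rewrite eqn_leq lt_u andbT leqNgt; apply/negP=> gt_u.
  have a_lt : ((u k).+1 < N.+1)%N by rewrite (leq_trans gt_u) // ltnW // ltn_ord.
  have /existsP[j /eqP wj] :=
    implyP (pk ((s^-1)%g (inord k.+1)) (Ordinal a_lt)) gt_u.
  have uj : u (s j) = (u k).+1 by rewrite us wj.
  have [j_le|j_gt] := leqP (s j) k.
    by have := u_mono (s j) k; rewrite j_le ltnW // uj ltnn => /(_ isT).
  by have := u_mono k.+1 (s j); rewrite j_gt s_le uj leqNgt gt_u => /(_ isT).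
apply/ffunP => i; rewrite ffunE; apply: val_inj.
by rewrite [LHS]val_stair // -uP ?s_le // us.
Qed.

(** * Sorting the positions of a word *)

(** [s] ranks the positions by [key].  Total orders on positions are given by
    injective keys into [nat]. *)
Definition sorts n (key : 'I_n -> nat) (s : 'S_n) : bool :=
  [forall i, forall j, (s i < s j)%N ==> (key i < key j)%N].

Lemma sortsP n (key : 'I_n -> nat) (s : 'S_n) :
  reflect (forall i j, (s i < s j)%N -> (key i < key j)%N) (sorts key s).
Proof. by apply: (iffP 'forall_forallP) => H i j; apply/implyP/H. Qed.

(** The converse implication is automatic because [s] is injective. *)
Lemma sorts_lt n (key : 'I_n -> nat) (s : 'S_n) i j :
  sorts key s -> (s i < s j)%N = (key i < key j)%N.
Proof.
move/sortsP=> sP; apply/idP/idP => [/sP//|ij].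
rewrite ltnNge leq_eqVlt; apply/norP; split.
  apply: contraTN ij => /eqP/val_inj/perm_inj->; by rewrite ltnn.
by apply: contraTN ij => /sP ji; rewrite -leqNgt ltnW.
Qed.

Lemma card_ord_lt n a : (a <= n)%N -> #|[set k : 'I_n | (k < a)%N]| = a.
Proof.
move=> a_le; rewrite -sum1dep_card -(big_ord_widen n (fun=> 1%N) a_le).
by rewrite sum1_card card_ord.
Qed.

Lemma card_perm_lt n (s : 'S_n) i : #|[set j | (s j < s i)%N]| = s i.
Proof.
rewrite -[RHS](card_ord_lt (ltnW (ltn_ord (s i)))) -[LHS](card_imset _ (@perm_inj _ s)).
apply: eq_card => k; rewrite inE; apply/imsetP/idP => [[j]|k_lt].
  by rewrite inE => sji ->.
by exists ((s^-1)%g k); rewrite ?inE permKV.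
Qed.

(** A sorting permutation is the rank function: [s i] counts the positions whose
    key is smaller than that of [i]. *)
Lemma sorts_uniq n (key : 'I_n -> nat) (s t : 'S_n) : sorts key s -> sorts key t -> s = t.
Proof.
move=> s_key t_key; apply/permP => i; apply: val_inj.
rewrite /= -(card_perm_lt s) -(card_perm_lt t); apply: eq_card => j.
by rewrite !inE (sorts_lt _ _ s_key) (sorts_lt _ _ t_key).
Qed.

Lemma sorts_exists n (key : 'I_n -> nat) : injective key -> exists s, sorts key s.
Proof.
move=> key_inj; pose below i := [set j | (key j < key i)%N].
have below_lt i : (#|below i| < n)%N.
  rewrite -[X in (_ < X)%N](card_ord n) -cardsT; apply: proper_card.
  by apply/properP; split; [apply: subsetT | exists i; rewrite ?inE ?ltnn].
have rank_mono i j : (key i < key j)%N -> (#|below i| < #|below j|)%N.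
  move=> ij; apply: proper_card; apply/properP; split.
    by apply/subsetP => k; rewrite !inE => /ltn_trans; apply.
  by exists i; rewrite !inE ?ltnn.
have rank_inj : injective (fun i => Ordinal (below_lt i)).
  move=> i j eq_ij; have {}eq_ij : #|below i| = #|below j| := congr1 val eq_ij.
  apply: key_inj; case: (ltngtP (key i) (key j)) => // /rank_mono.
    by rewrite eq_ij ltnn.
  by rewrite eq_ij ltnn.
exists (perm rank_inj); apply/sortsP => i j; rewrite !permE /= => lt_ij.
rewrite ltnNge leq_eqVlt; apply/norP; split.
  by apply: contraTN lt_ij => /eqP/key_inj->; rewrite ltnn.
by apply: contraTN lt_ij => /rank_mono ji; rewrite -leqNgt ltnW.
Qed.

Lemma jumps_stair m N (D : m.-tuple bool) (s : 'S_m.+1) : (m <= N)%N ->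
  jumps (wperm (stair m N D) s) s = D.
Proof.
move=> mN; apply/val_inj/(@eq_from_nth _ false); rewrite ?size_tuple // => k k_lt.
rewrite nth_jumps // !wpermE !permKV !val_stair // !inordK ?ltnS //; last exact: ltnW.
by rewrite heightS ?size_tuple // -[X in (X < _)%N]addn0 ltn_add2l; case: nth.
Qed.

(** The argument shared by standardization and the Gessel-Reutenauer
    correspondence.  A packed word [w] is a stair word read through a permutation
    [s]; once [s] is required to sort the key of [w], both [s] and the composition
    are determined by [w].  The predicate [nice] describes the resulting pairs
    without mentioning [w]. *)
Lemma sum_packed (R : comNzRingType) (c : nat -> R) m N (P : pred (word m N))
    (key : word m N -> 'I_m.+1 -> nat) (nice : m.-tuple bool -> 'S_m.+1 -> bool) :
    c 0 = 1 -> (m <= N)%N ->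
    (forall w, P w -> injective (key w)) ->
    (forall (w : word m N) i j, (w i < w j)%N -> (key w i < key w j)%N) ->
    (forall D s, nice D s
       = P (wperm (stair m N D) s) && sorts (key (wperm (stair m N D) s)) s) ->
  \sum_(w : word m N | packed w && P w) weight c w
  = \sum_(s : 'S_m.+1) \sum_(D : m.-tuple bool | nice D s) runprod c 1 D.
Proof.
move=> c0 mN key_inj key_lt niceE.
pose sorter w := odflt 1%g [pick s | sorts (key w) s].
have sorterP w : P w -> sorts (key w) (sorter w).
  move=> /key_inj/sorts_exists[s s_key]; rewrite /sorter; case: pickP => //= /(_ s).
  by rewrite s_key.
rewrite pair_big_dep /=.
rewrite (reindex_onto (fun sD : 'S_m.+1 * m.-tuple bool => wperm (stair m N sD.2) sD.1)
   (fun w => (sorter w, jumps w (sorter w)))) /=; last first.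
  move=> w /andP[pk Pw]; apply: packed_factor => // i j.
  rewrite (sorts_lt _ _ (sorterP _ Pw)) => ij; rewrite leqNgt.
  by apply/negP => /key_lt; rewrite ltnNge (ltnW ij).
apply: eq_big => [[s D]|[s D] _] /=; last by rewrite weight_wperm weight_stair.
rewrite packed_stair // niceE /=; apply: andb_id2l => Pw.
apply/eqP/idP => [[eq_s _]|s_key]; first by have := sorterP _ Pw; rewrite eq_s.
by rewrite (sorts_uniq (sorterP _ Pw) s_key) jumps_stair.
Qed.

(** * Descents and increasing blocks *)

Definition descents m (p : 'S_m.+1) : seq bool := mkseq (descent p) m.

Lemma size_descents m (p : 'S_m.+1) : size (descents p) = m.
Proof. exact: size_mkseq. Qed.

Lemma descentE m (p : 'S_m.+1) i : (i < m)%N ->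
  descent p i = (p (inord i.+1) < p (inord i))%N.
Proof.
move=> i_lt; apply/existsP/idP => [[x /existsP[y /and3P[/eqP <- /eqP <-]]]|des].
  by rewrite !inord_val.
exists (inord i); apply/existsP; exists (inord i.+1).
by rewrite /= !inordK ?eqxx //= ltnW.
Qed.

Lemma ascentE m (p : 'S_m.+1) i : ascent p i = (i < m)%N && ~~ descent p i.
Proof.
case: (ltnP i m) => [i_lt|i_ge] /=; last first.
  apply/existsP => -[x /existsP[y /and3P[/eqP xi /eqP yi _]]].
  by have := ltn_ord y; rewrite /= yi ltnS ltnNge i_ge.
rewrite descentE // -leqNgt leq_eqVlt.
have /negPf -> : p (inord i) != p (inord i.+1) :> nat.
  apply: contraTneq isT => /val_inj/perm_inj/(congr1 val)/=.
  by rewrite !inordK ?ltnS // 1?ltnW // => /n_Sn.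
apply/existsP/idP => [[x /existsP[y /and3P[/eqP <- /eqP <-]]]|des].
  by rewrite !inord_val.
exists (inord i); apply/existsP; exists (inord i.+1).
by rewrite /= !inordK ?eqxx //= ltnW.
Qed.

Lemma bits_leP b (D : seq bool) : size b = size D ->
  reflect (forall i, (i < size b)%N -> nth false b i -> nth false D i) (bits_le b D).
Proof.
move=> eq_sz; rewrite /bits_le all2E eq_sz eqxx /=.
apply: (iffP (all_nthP (false, false))) => H i i_lt.
  move=> bi; have := H i; rewrite size_zip eq_sz minnn nth_zip //=.
  by rewrite bi; apply.
move: i_lt; rewrite size_zip eq_sz minnn nth_zip //= => i_lt.
by apply/implyP/H.
Qed.

(** The ascents inside a block chain together, so that absence of descents away
    from the cuts of [D] means monotonicity on each of its blocks. *)
Lemma refinesP m (p : 'S_m.+1) (D : m.-tuple bool) :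
  reflect (forall k l : 'I_m.+1, (k < l)%N -> height D k = height D l -> (p k < p l)%N)
          (bits_le (descents p) D).
Proof.
apply: (iffP (bits_leP _)); rewrite ?size_descents ?size_tuple // => H.
  move=> k [l l_lt] /= kl; elim: l l_lt kl => // l IHl l_lt.
  rewrite ltnS => kl ht_kl.
  have l_lt' : (l < m.+1)%N by apply: ltnW.
  have ht_l : height D k = height D l.
    apply/eqP; rewrite eqn_leq height_mono ?kl ?size_tuple //=.
    by rewrite ht_kl height_mono // leqnSn size_tuple.
  have pS : (p (Ordinal l_lt') < p (Ordinal l_lt))%N.
    have D_l : nth false D l = false.
      move: ht_kl; rewrite ht_l heightS ?size_tuple // -[X in X = _]addn0.
      by move/addnI; case: nth.
    have := H l l_lt; rewrite nth_mkseq // D_l descentE //.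
    have -> : inord l = Ordinal l_lt' by apply: val_inj; rewrite /= inordK.
    have -> : inord l.+1 = Ordinal l_lt by apply: val_inj; rewrite /= inordK.
    move=> ge; rewrite ltn_neqAle leqNgt; apply/andP; split.
      by apply/eqP => /val_inj/perm_inj[] /n_Sn.
    by apply/negP => /ge.
  move: kl; rewrite leq_eqVlt => /predU1P[kl|kl].
    by rewrite (_ : k = Ordinal l_lt') //; apply: val_inj.
  exact: ltn_trans (IHl l_lt' kl ht_l) pS.
move=> i i_lt; rewrite nth_mkseq // descentE //; apply: contraTT => D_i.
rewrite -leqNgt ltnW // H ?inordK ?ltnS // 1?ltnW //.
by rewrite heightS ?size_tuple // (negPf D_i) addn0.
Qed.

Lemma sum_refinements_descents (R : comNzRingType) (c v : nat -> R) m (p : 'S_m.+1) :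
    v 0 = 1 -> (forall r, v r.+1 = run_conv c v 1 r) ->
  \sum_(D : m.-tuple bool | bits_le (descents p) D) runprod c 1 D
  = runprod v 1 (descents p).
Proof.
move=> v0 conv; rewrite -(sum_refinements _ v0 conv).
by move: (descents p) (size_descents p) => b <-.
Qed.

(** * Standardization *)

Lemma digit_lt M a b i j : (i < M)%N -> (j < M)%N ->
  (a * M + i < b * M + j)%N = (a < b)%N || (a == b) && (i < j)%N.
Proof.
have lt_digit a' b' i' j' : (i' < M)%N -> (a' < b')%N -> (a' * M + i' < b' * M + j')%N.
  move=> i_lt ab; apply: (@leq_trans (a'.+1 * M)); first by rewrite mulSn addnC ltn_add2r.
  by rewrite (leq_trans (leq_mul ab (leqnn M))) ?leq_addr.
move=> i_lt j_lt; case: (ltngtP a b) => [ab|ba|->] /=; last by rewrite ltn_add2l.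
  by rewrite lt_digit.
by apply/negbTE; rewrite -leqNgt ltnW // lt_digit.
Qed.

(** Standardization: positions are ordered by letter, then from left to right.
    A permutation sorts this key exactly when its inverse is increasing on the
    blocks of equal letters. *)
Lemma sum_packed_runs (R : comNzRingType) (c v : nat -> R) m N :
    c 0 = 1 -> v 0 = 1 -> (forall r, v r.+1 = run_conv c v 1 r) -> (m <= N)%N ->
  \sum_(w : word m N | packed w) weight c w
  = \sum_(s : 'S_m.+1) runprod v 1 (descents s).
Proof.
move=> c0 v0 conv mN.
(* Lexicographic order on pairs (letter, position), read in base [m.+1]. *)
pose key (w : word m N) (i : 'I_m.+1) := (w i * m.+1 + i)%N.
have key_lt (w : word m N) i j :
  (key w i < key w j)%N = (w i < w j)%N || (w i == w j) && (i < j)%N.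
  exact: digit_lt.
rewrite (reindex_inj (@invg_inj _)) /=.
transitivity (\sum_(s : 'S_m.+1) \sum_(D : m.-tuple bool | bits_le (descents s^-1%g) D)
                runprod c 1 D); last first.
  by apply: eq_bigr => s _; apply: sum_refinements_descents.
transitivity (\sum_(w : word m N | packed w && predT w) weight c w).
  by apply: eq_bigl => w; rewrite andbT.
apply: (@sum_packed _ _ _ _ _ key) => //= [w _ i j ij|w i j ij|D s].
- apply: val_inj; have := key_lt w i j; have := key_lt w j i.
  rewrite ij !ltnn -!val_eqE /=.
  by case: (ltngtP (w i) (w j)) => //= _; case: (ltngtP i j).
- by rewrite key_lt ij.
apply/refinesP/sortsP => H.
  move=> i j sij; rewrite key_lt !wpermE -val_eqE /= !val_stair //.
  have := @height_mono D (s i) (s j); rewrite size_tuple ltnW //= -ltnS ltn_ord.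
  move=> /(_ isT); rewrite leq_eqVlt => /predU1P[eq_ht|->//].
  by rewrite eq_ht eqxx orbC; have := H _ _ sij eq_ht; rewrite !permK => ->.
move=> k l kl ht_kl; have := H (s^-1 k)%g (s^-1 l)%g; rewrite !permKV => /(_ kl).
by rewrite key_lt !wpermE !permKV -val_eqE /= !val_stair // ht_kl ltnn eqxx.
Qed.

(** * Primitive words and full cycles *)

Definition shift m : 'S_m.+1 := perm (@ordS_inj m.+1).

Lemma shiftX m d (i : 'I_m.+1) : (shift m ^+ d)%g i = ((i + d) %% m.+1)%N :> nat.
Proof.
elim: d => [|d IHd]; first by rewrite expg0 perm1 addn0 modn_small.
by rewrite expgSr permM permE /= IHd -addn1 modnDml addn1 addnS.
Qed.

Lemma shift_order m : (shift m ^+ m.+1 = 1)%g.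
Proof.
by apply/permP => i; apply: val_inj; rewrite /= shiftX perm1 modnDr modn_small.
Qed.

(** Invariance under rotation by [d] places. *)
Definition period m N (w : word m N) (d : nat) : bool :=
  [forall x, w ((shift m ^+ d)%g x) == w x].

Definition primitive m N (w : word m N) : bool :=
  [forall d : 'I_m.+1, (0 < d)%N ==> ~~ period w d].

Section Rotations.

Variables (m N : nat) (w : word m N).

(** The [t] letters read cyclically from position [i], as the digits of a number in
    base [N.+1]: the lexicographic order on rotations becomes the order of [nat]. *)
Fixpoint rotkey (t : nat) (i : 'I_m.+1) : nat :=
  if t is t'.+1 then (w i * N.+1 ^ t' + rotkey t' (shift m i))%N else 0.

Lemma rotkey_lt t i : (rotkey t i < N.+1 ^ t)%N.
Proof.
elim: t i => [|t IHt] i //=; rewrite expnS (@leq_trans ((w i).+1 * N.+1 ^ t)) //.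
  by rewrite mulSn addnC ltn_add2r.
by rewrite leq_mul2r ltn_ord orbT.
Qed.

Lemma rotkey_split t i j : (w i < w j)%N -> (rotkey t.+1 i < rotkey t.+1 j)%N.
Proof. by move=> wij; rewrite /= digit_lt ?rotkey_lt // wij. Qed.

Lemma rotkey_rcons t i :
  rotkey t.+1 i = (N.+1 * rotkey t i + w ((shift m ^+ t)%g i))%N.
Proof.
elim: t i => [|t IHt] i; first by rewrite /= expg0 perm1 muln0 muln1 addn0.
transitivity (w i * N.+1 ^ t.+1 + rotkey t.+1 (shift m i))%N; first by [].
by rewrite IHt expgS permM /= mulnDr addnA mulnCA -expnS.
Qed.

(** Rotations that agree on their first letter compare like the rotations started
    one place later: dropping the common first digit and appending it at the end
    is the same affine map on both keys. *)
Lemma rotkey_shift i j : w i = w j -> (rotkey m.+1 i < rotkey m.+1 j)%N ->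
  (rotkey m.+1 (shift m i) < rotkey m.+1 (shift m j))%N.
Proof.
move=> wij; have := rotkey_rcons m.+1 i; have := rotkey_rcons m.+1 j.
rewrite shift_order !perm1 wij.
change (rotkey m.+2 i) with (w i * N.+1 ^ m.+1 + rotkey m.+1 (shift m i))%N.
change (rotkey m.+2 j) with (w j * N.+1 ^ m.+1 + rotkey m.+1 (shift m j))%N.
rewrite wij => eq_j eq_i lt_key; rewrite -(ltn_add2l (w j * N.+1 ^ m.+1)%N) eq_i eq_j.
by rewrite ltn_add2r ltn_pmul2l.
Qed.

Lemma rotkey_eq t i j : rotkey t i = rotkey t j ->
  forall d, (d < t)%N -> w ((shift m ^+ d)%g i) = w ((shift m ^+ d)%g j).
Proof.
elim: t i j => // t IHt i j eq_key.
have wij : w i = w j.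
  by apply: val_inj; case: (ltngtP (w i) (w j)) => // /(@rotkey_split t);
     rewrite eq_key ltnn.
case=> [_|d d_lt]; first by rewrite expg0 !perm1.
rewrite expgS !permM; apply: IHt => //.
by move: eq_key; rewrite /= wij => /addnI.
Qed.

(** Two equal rotations, started [d] places apart, make [d] a period. *)
Lemma rotkey_inj : primitive w -> injective (rotkey m.+1).
Proof.
move=> /forallP prim.
suff lt_absurd (i j : 'I_m.+1) : (i < j)%N -> rotkey m.+1 i = rotkey m.+1 j -> False.
  move=> i j eq_key; apply: val_inj; case: (ltngtP i j) => // lt_ij.
    by case: (lt_absurd i j).
  by case: (lt_absurd j i).
move=> ij eq_key.
have d_lt : (j - i < m.+1)%N by rewrite (leq_ltn_trans (leq_subr _ _)).
have /implyP := prim (Ordinal d_lt); rewrite /= subn_gt0 => /(_ ij)/negP; apply.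
apply/forallP => x.
have [t t_lt ->] : exists2 t, (t < m.+1)%N & x = (shift m ^+ t)%g i.
  exists ((x + (m.+1 - i)) %% m.+1)%N; first exact: ltn_pmod.
  apply: val_inj; rewrite /= shiftX modnDmr addnCA subnKC ?(ltnW (ltn_ord i)) //.
  by rewrite modnDr modn_small.
have jE : j = (shift m ^+ (j - i))%g i.
  by apply: val_inj; rewrite /= shiftX subnKC ?(ltnW ij) // modn_small.
rewrite -permM -expgD addnC expgD permM -jE.
by rewrite (rotkey_eq eq_key).
Qed.

End Rotations.

(** The [n]-cycle that visits [s 0], [s 1], [s 2], and so on. *)
Definition cycle_of m (s : 'S_m.+1) : 'S_m.+1 := (shift m ^ s)%g.

Lemma cycle_ofE m (s : 'S_m.+1) i : cycle_of s (s i) = s (shift m i).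
Proof. by rewrite /cycle_of permJ. Qed.

Lemma cycle_ofX m (s : 'S_m.+1) t i : (cycle_of s ^+ t)%g (s i) = s ((shift m ^+ t)%g i).
Proof. by rewrite /cycle_of -conjXg permJ. Qed.

Lemma full_cycleP m (p : 'S_m.+1) : reflect (forall x, porbit p x = setT) (is_full_cycle p).
Proof.
apply: (iffP eqP) => [H x | H].
  by apply/set1P; rewrite -H imset_f.
apply/setP => A; rewrite inE; apply/imsetP/eqP => [[x _ ->]|->]; first exact: H.
by exists ord0; rewrite // -H.
Qed.

Lemma cycle_of_full m (s : 'S_m.+1) : is_full_cycle (cycle_of s).
Proof.
apply/full_cycleP => x; apply/setP => y; rewrite in_setT.
rewrite -(permKV s x) -(permKV s y); move: (s^-1 x)%g (s^-1 y)%g => i j.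
have -> : j = (shift m ^+ (j + (m.+1 - i)))%g i.
  apply: val_inj; rewrite /= shiftX addnCA subnKC ?(ltnW (ltn_ord i)) //.
  by rewrite modnDr modn_small.
by rewrite -cycle_ofX mem_porbit.
Qed.

(** A permutation [s] with [cycle_of s = p] lists the cycle [p] from some starting
    point, and is determined by that point [s 0]. *)
Lemma card_cycle_of m (p : 'S_m.+1) : is_full_cycle p ->
  #|[set s | cycle_of s == p]| = m.+1.
Proof.
move=> /full_cycleP p_full.
have s0_inj : {in [set s | cycle_of s == p] &, injective (fun s : 'S_m.+1 => s ord0)}.
  move=> s t; rewrite !inE => /eqP sp /eqP tp st0; apply/permP => i.
  have -> : i = (shift m ^+ i)%g ord0.
    by apply: val_inj; rewrite /= shiftX add0n modn_small.
  by rewrite -!cycle_ofX sp tp st0.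
rewrite -(card_in_imset s0_inj) -[RHS](card_ord m.+1) -cardsT.
apply: eq_card => x; rewrite in_setT; apply/imsetP.
have card_x : #|porbit p x| = m.+1 by rewrite p_full cardsT card_ord.
have px_inj : injective (fun i : 'I_m.+1 => (p ^+ i)%g x).
  move=> i j eq_ij; apply: val_inj.
  have := uniq_traject_porbit p x; rewrite card_x => /(nth_uniq x).
  move=> /(_ i j); rewrite size_traject !ltn_ord => /(_ isT isT).
  by rewrite !nth_traject // -!permX eq_ij eqxx => /esym/eqP.
exists (perm px_inj); last by rewrite permE expg0 perm1.
rewrite inE; apply/eqP/permP => y.
rewrite -(permKV (perm px_inj) y); move: ((perm px_inj)^-1 y)%g => i.
rewrite cycle_ofE !permE /=.
rewrite -permM -expgSr; have := ltn_ord i; rewrite ltnS leq_eqVlt => /predU1P[->|i_lt].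
  by rewrite modnn expg0 perm1 permX; have := iter_porbit p x; rewrite card_x => ->.
by rewrite modn_small.
Qed.

Lemma sum_cycle_of (R : comNzRingType) m (F : 'S_m.+1 -> R) :
  \sum_(s : 'S_m.+1) F (cycle_of s) = m.+1%:R * \sum_(p : 'S_m.+1 | is_full_cycle p) F p.
Proof.
rewrite (partition_big (@cycle_of m) (@is_full_cycle _)) /=; last first.
  by move=> s _; apply: cycle_of_full.
rewrite mulr_sumr; apply: eq_bigr => p p_full.
rewrite (eq_bigr (fun=> F p)) => [|s /eqP-> //].
by rewrite sumr_const mulr_natl -cardsE (card_cycle_of p_full).
Qed.

(** If [d] were a period, the points [x] and [p^d x] would always lie in the same
    blocks, so that [p] would preserve their order forever.  Starting from the
    minimum 0, the iterates of [p^d] would then increase strictly [n] times. *)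
Lemma stair_cycle_primitive m N (D : m.-tuple bool) (s : 'S_m.+1) : (m <= N)%N ->
  bits_le (descents (cycle_of s)) D -> primitive (wperm (stair m N D) s).
Proof.
move=> mN /refinesP incr; set p := cycle_of s in incr.
apply/forallP => d; apply/implyP => d_gt0; apply/negP => /forallP per.
have ht_d x : height D ((p ^+ d)%g x) = height D x.
  have := per (s^-1 x)%g; rewrite !wpermE -val_eqE /= !val_stair // permKV => /eqP <-.
  by rewrite -cycle_ofX permKV.
have pres t (x y : 'I_m.+1) : (x < y)%N ->
    (forall u, height D ((p ^+ u)%g x) = height D ((p ^+ u)%g y)) ->
    ((p ^+ t)%g x < (p ^+ t)%g y)%N.
  move=> xy eq_ht; elim: t => [|t IHt]; first by rewrite expg0 !perm1.
  by rewrite expgSr !(permM (p ^+ t)%g p); apply: incr.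
pose q := (p ^+ d)%g.
have q0 : (0 < q ord0)%N.
  rewrite lt0n; apply/negP => /eqP q00.
  have /(congr1 val) : (shift m ^+ d)%g (s^-1 ord0)%g = (s^-1 ord0)%g.
    apply: (@perm_inj _ s); rewrite -cycle_ofX !permKV; exact: val_inj.
  rewrite /= shiftX; move: (s^-1 ord0)%g => i.
  have [lt_m|ge_m] := ltnP (i + d) m.+1.
    by rewrite modn_small // => /eqP; rewrite -[X in _ == X]addn0 eqn_add2l gtn_eqF.
  rewrite -(subnK ge_m) modnDr modn_small; have := ltn_ord d; have := ltn_ord i; lia.
have qX_ge t : (t <= (q ^+ t)%g ord0)%N.
  elim: t => // t IHt; apply: (leq_ltn_trans IHt).
  rewrite expgS (permM q) /q -expgM.
  apply: pres => // u; rewrite -(permM (p ^+ d)%g) -expgD addnC expgD.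
  by rewrite (permM (p ^+ u)%g) ht_d.
have := qX_ge m.+1; rewrite leqNgt ltn_ord //.
Qed.

(** The Gessel-Reutenauer correspondence: positions are ordered by the rotations
    that start there.  The cycle is increasing on blocks because rotations with
    the same first letter compare like their shifts; conversely, monotonicity on
    blocks forces the order of the cycle's points to be the order of rotations. *)
Lemma sum_primitive_runs (R : comNzRingType) (c v : nat -> R) m N :
    c 0 = 1 -> v 0 = 1 -> (forall r, v r.+1 = run_conv c v 1 r) -> (m <= N)%N ->
  \sum_(w : word m N | packed w && primitive w) weight c w
  = m.+1%:R * \sum_(p : 'S_m.+1 | is_full_cycle p) runprod v 1 (descents p).
Proof.
move=> c0 v0 conv mN; rewrite -sum_cycle_of.
transitivity (\sum_(s : 'S_m.+1)
    \sum_(D : m.-tuple bool | bits_le (descents (cycle_of s)) D) runprod c 1 D); last first.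
  by apply: eq_bigr => s _; apply: sum_refinements_descents.
apply: (@sum_packed _ _ _ _ _ (fun w => rotkey w m.+1)) => //.
- by move=> w; apply: rotkey_inj.
- by move=> w i j; apply: rotkey_split.
move=> D s; set w := wperm _ s; set p := cycle_of s.
have wE i : w i = height D (s i) :> nat by rewrite wpermE val_stair.
have ht_mono k l : (k <= l)%N -> (l <= m)%N -> (height D k <= height D l)%N.
  by move=> kl lm; apply: height_mono; rewrite kl size_tuple.
apply/idP/andP => [des_D|[prim /sortsP s_key]].
  have prim := stair_cycle_primitive mN des_D; split=> //.
  have /refinesP incr := des_D.
  (* Either the first letters already differ, or both points lie in one block
     and the cycle moves them forward in the same order. *)
  have key_le t i j : (s i < s j)%N -> (rotkey w t i <= rotkey w t j)%N.
    elim: t i j => // t IHt i j sij.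
    have := ht_mono _ _ (ltnW sij) (ltn_ord (s j)).
    rewrite leq_eqVlt => /predU1P[eq_ht|lt_ht].
      have /= := incr _ _ sij eq_ht; rewrite -/p !cycle_ofE => /IHt.
      by rewrite !wE eq_ht leq_add2l.
    by rewrite ltnW // rotkey_split // !wE.
  apply/sortsP => i j sij; rewrite ltn_neqAle key_le // andbT.
  by apply: contraTneq sij => /(rotkey_inj prim)->; rewrite ltnn.
apply/refinesP => k l; rewrite -(permKV s k) -(permKV s l).
move: (s^-1 k)%g (s^-1 l)%g => i j sij; rewrite -!wE => /val_inj wij.
have lt_key := rotkey_shift wij (s_key _ _ sij).
rewrite !cycle_ofE ltnNge leq_eqVlt; apply/negP => /predU1P[|/s_key].
  by move/val_inj/perm_inj/perm_inj => ji; move: sij; rewrite ji ltnn.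
by rewrite ltnNge ltnW.
Qed.

(** * The Moebius function *)

Lemma mobiusE n : (0 < n)%N ->
  mobius n = if all (fun p => logn p n == 1%N) (primes n)
             then (-1) ^+ size (primes n) else 0.
Proof.
by move=> n_gt0; rewrite /mobius prime_decompE n_gt0 all_map size_map.
Qed.

Lemma mobius_primeM p m : prime p -> (0 < m)%N ->
  mobius (p * m) = if (p %| m)%N then 0 else - mobius m.
Proof.
move=> p_pr m_gt0; have p_gt0 := prime_gt0 p_pr.
have lognE q : logn q (p * m) = ((q == p) + logn q m)%N.
  by rewrite lognM // logn_prime.
have mem_pm q : (q \in primes (p * m)) = (q == p) || (q \in primes m).
  by rewrite primesM // primes_prime // inE.
rewrite !mobiusE ?muln_gt0 ?p_gt0 //; have [p_m | pNm] := boolP (p %| m)%N; last first.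
have perm_pm : perm_eq (primes (p * m)) (p :: primes m).
  apply: uniq_perm; rewrite ?primes_uniq //= ?primes_uniq ?andbT.
  by rewrite mem_primes (negPf pNm) !andbF.
rewrite (perm_size perm_pm) (perm_all _ perm_pm) /= lognE eqxx.
have -> : logn p m = 0%N.
  by apply/eqP; rewrite -leqn0 leqNgt logn_gt0 mem_primes (negPf pNm) !andbF.
  rewrite /= exprS mulN1r.
have -> : all (fun q => logn q (p * m) == 1%N) (primes m)
          = all (fun q => logn q m == 1%N) (primes m).
  apply: eq_in_all => q; rewrite lognE mem_primes => /and3P[_ _ q_m].
  by have /negPf-> : q != p by apply: contraNneq pNm => <-.
  by case: ifP; rewrite ?oppr0.
  case: ifP => // /allP all1; have := all1 p; rewrite mem_pm eqxx lognE eqxx /= => /(_ isT).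
  by rewrite eqSS -leqn0 leqNgt logn_gt0 mem_primes p_pr m_gt0 p_m.
Qed.

Lemma big_divisors_prime (p n : nat) (F : nat -> int) : prime p -> (0 < n)%N ->
  \sum_(d <- divisors (p * n) | (p %| d)%N) F d
  = \sum_(d <- divisors n) F (p * d)%N.
Proof.
move=> p_pr n_gt0; have p_gt0 := prime_gt0 p_pr.
rewrite -[LHS]big_filter -[RHS](big_map (muln p) predT F).
apply: perm_big; apply: uniq_perm.
- by rewrite filter_uniq // divisors_uniq.
- by rewrite map_inj_uniq ?divisors_uniq // => x y /eqP; rewrite eqn_pmul2l // => /eqP.
move=> d; rewrite mem_filter -dvdn_divisors ?muln_gt0 ?p_gt0 //.
apply/andP/mapP => [[/dvdnP[e ->]]|[e]].
  rewrite mulnC dvdn_pmul2l // => e_n.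
  by exists e; rewrite // -dvdn_divisors.
by rewrite -dvdn_divisors // => e_n ->; rewrite dvdn_mulr // dvdn_pmul2l.
Qed.

Lemma big_divisors_coprime (p n : nat) (F : nat -> int) : prime p -> (0 < n)%N ->
  \sum_(d <- divisors (p * n) | ~~ (p %| d)%N) F d
  = \sum_(d <- divisors n | ~~ (p %| d)%N) F d.
Proof.
move=> p_pr n_gt0; have p_gt0 := prime_gt0 p_pr.
rewrite -[LHS]big_filter -[RHS]big_filter; apply: perm_big; apply: uniq_perm.
- by rewrite filter_uniq // divisors_uniq.
- by rewrite filter_uniq // divisors_uniq.
move=> d; rewrite !mem_filter -!dvdn_divisors ?muln_gt0 ?p_gt0 //.
have [//|pNd] /= := boolP (p %| d)%N.
by rewrite Gauss_dvdr // coprime_sym prime_coprime.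
Qed.

(** For a prime [p] dividing [n], the divisors [d] prime to [p] cancel against
    the divisors [p * d]; multiples of [p^2] contribute 0. *)
Lemma sum_mobius n : (0 < n)%N ->
  \sum_(d <- divisors n) mobius d = (n == 1)%:R.
Proof.
have [->|n_neq1 n_gt0] := eqVneq n 1%N.
  by move=> _; rewrite big_cons big_nil addr0.
have n_gt1 : (1 < n)%N by lia.
have p_pr := pdiv_prime n_gt1; have /dvdnP[m def_n] := pdiv_dvd n.
move: (pdiv n) p_pr def_n => p p_pr; rewrite mulnC => def_n.
have m_gt0 : (0 < m)%N by move: n_gt0; rewrite def_n muln_gt0 => /andP[].
rewrite def_n (bigID (dvdn p)) /= big_divisors_prime // big_divisors_coprime //.
rewrite (eq_big_seq (fun d => - (if ~~ (p %| d)%N then mobius d else 0))).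
  by rewrite sumrN -big_mkcond /= addNr.
move=> d; rewrite -dvdn_divisors // => d_m.
by rewrite mobius_primeM ?(dvdn_gt0 m_gt0) //; case: ifP; rewrite //= oppr0.
Qed.


(** Used with [q * m] the length of a word and [q] its least period: the
    exponents of which the word is a power are the divisors of [m]. *)
Lemma big_divisors_cofactor (q m : nat) (F : nat -> int) :
    (0 < q)%N -> (0 < m)%N ->
  \sum_(d <- divisors (q * m) | (d %| m)%N) F d = \sum_(d <- divisors m) F d.
Proof.
move=> q_gt0 m_gt0.
rewrite -[LHS]big_filter; apply: perm_big; apply: uniq_perm.
- by rewrite filter_uniq // divisors_uniq.
- by rewrite divisors_uniq.
move=> d; rewrite !mem_filter -!dvdn_divisors ?muln_gt0 ?q_gt0 //.
by apply: andb_idr; apply: dvdn_mull.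
Qed.

(** Since (-1)^k = 2 [2 | k] - 1, the sum is twice the Moebius sum over the divisors
    of [n / 2], if [n] is even, minus the one over the divisors of [n]. *)
Lemma sum_mobius_sign n : (0 < n)%N ->
  \sum_(d <- divisors n) mobius d * (-1) ^+ (n %/ d)%N
  = (n == 2)%:R *+ 2 - (n == 1)%:R.
Proof.
move=> n_gt0.
rewrite (eq_big_seq (fun d =>
  (if (2 %| n %/ d)%N then mobius d else 0) *+ 2 - mobius d)); last first.
  move=> d _; rewrite dvdn2 -signr_odd.
  by case: odd => /=; rewrite ?expr0 ?expr1; ring.
rewrite sumrB sum_mobius // sumrMnl -big_mkcond /=; congr (_ *+ _ - _).
have [/dvdnP[m def_n]|n_odd] := boolP (2 %| n)%N; last first.
  rewrite big1_seq => [|d /andP[d2 d_n]].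
    by move: n_odd; case: eqP => // ->.
  move: d_n d2; rewrite -dvdn_divisors // => /dvdnP[e def_n].
  have d_gt0 : (0 < d)%N by move: n_gt0; rewrite def_n muln_gt0 => /andP[].
  by rewrite def_n mulnK // => e2; move: n_odd; rewrite def_n dvdn_mulr.
have m_gt0 : (0 < m)%N by move: n_gt0; rewrite def_n muln_gt0 => /andP[].
rewrite mulnC in def_n; subst n.
rewrite (_ : (2 * m == 2)%N = (m == 1)%N); last by lia.
rewrite -sum_mobius // -(@big_divisors_cofactor 2) //.
rewrite big_seq_cond [RHS]big_seq_cond; apply: eq_bigl => d.
rewrite -dvdn_divisors ?muln_gt0 //; apply: andb_id2l => d_n.
have d_gt0 := dvdn_gt0 n_gt0 d_n.
by rewrite -(dvdn_pmul2r d_gt0) divnK // dvdn_pmul2l.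
Qed.

(** Write [n = 3^(a+1) * k] with [k] prime to 3.  A divisor that is a multiple of 3
    contributes only if it is 3 times a divisor of [k], and the factor 3^a does
    not change parities; what is left is [- sum_mobius_sign k], which is nonzero
    for [k = 1] and [k = 2] only. *)
Lemma thetaE n : (0 < n)%N ->
  theta n = \sum_(d <- divisors n | (3 %| d)%N) mobius d * (-1) ^+ (n %/ d)%N.
Proof.
move=> n_gt0.
have [/dvdnP[m def_n]|n3] := boolP (3 %| n)%N; last first.
  rewrite /theta big1_seq => [|d /andP[d3]]; last first.
    by rewrite -dvdn_divisors // => /(dvdn_trans d3); rewrite (negPf n3).
  case: existsP => [[[[|a] a_lt] /andP[//= _ /eqP def_n]]|_].
    by case/negP: n3; rewrite def_n expnS dvdn_mulr.
  case: existsP => [[[[|a] a_lt] /andP[//= _ /eqP def_n]]|_] //.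
  by case/negP: n3; rewrite def_n expnS mulnCA dvdn_mulr.
have m_gt0 : (0 < m)%N by move: n_gt0; rewrite def_n muln_gt0 => /andP[].
rewrite mulnC in def_n; subst n.
rewrite big_divisors_prime //.
transitivity (- \sum_(d <- divisors m | ~~ (3 %| d)%N)
                mobius d * (-1) ^+ (m %/ d)%N); last first.
  rewrite [in LHS]big_mkcond /= -sumrN; apply: eq_big_seq => d.
  rewrite -dvdn_divisors // => d_m.
  rewrite divnMl // mobius_primeM ?(dvdn_gt0 m_gt0) //.
  by case: (3 %| d)%N; rewrite ?mulNr ?mul0r ?oppr0.
have [] := @pfactor_coprime 3 m isT m_gt0; set a := logn 3 m => k co_3k def_m.
have k_gt0 : (0 < k)%N by move: m_gt0; rewrite def_m muln_gt0 => /andP[].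
have -> : \sum_(d <- divisors m | ~~ (3 %| d)%N) mobius d * (-1) ^+ (m %/ d)%N
   = \sum_(d <- divisors k) mobius d * (-1) ^+ (k %/ d)%N.
  rewrite -(@big_divisors_cofactor (3 ^ a)) ?expn_gt0 // mulnC -def_m.
  rewrite big_seq_cond [RHS]big_seq_cond; apply: eq_big => d.
    rewrite -dvdn_divisors // def_m; apply/andP/andP => -[d_m].
      move=> d3; split=> //; move: d_m; rewrite Gauss_dvdl //.
      by rewrite coprimeXr // coprime_sym prime_coprime.
    move=> d_k; split=> //.
    apply/negP=> d3; move: co_3k; rewrite prime_coprime //.
    by rewrite (dvdn_trans d3 d_k).
  rewrite -dvdn_divisors // => /andP[d_m d3]; congr (_ * _).
  have d_k : (d %| k)%N.
    move: d_m; rewrite def_m Gauss_dvdl //.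
    by rewrite coprimeXr // coprime_sym prime_coprime.
  rewrite def_m -divn_mulAC // -signr_odd oddM oddX orbT andbT.
  by rewrite signr_odd.
rewrite sum_mobius_sign // def_m /theta.
have bnd : (a.+1 < (3 * (k * 3 ^ a)).+1)%N.
  rewrite ltnS (leq_trans (ltn_expl a (isT : 1 < 3)%N)) //.
  by rewrite (leq_trans (leq_pmull _ k_gt0)) // leq_pmull.
case: existsP => [[[[|b] b_lt] /andP[//= _ /eqP def_b]]|not_pow].
  have k1 : k = 1%N.
    have : (k %| 3 ^ b.+1)%N by rewrite -def_b mulnCA dvdn_mulr.
    by rewrite -(mul1n (3 ^ _)%N) Gauss_dvdl ?coprimeXr 1?coprime_sym // dvdn1 => /eqP.
  by rewrite k1.
have k_neq1 : (k == 1%N) = false.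
  apply/eqP => k1; case: not_pow; exists (Ordinal bnd) => /=.
  by rewrite k1 mul1n expnS.
rewrite k_neq1 subr0.
case: existsP => [[[[|b] b_lt] /andP[//= _ /eqP def_b]]|not_pow2].
  suff -> : k = 2%N by [].
  have : (k %| 2)%N.
    rewrite -(@Gauss_dvdl _ _ (3 ^ b.+1)%N) ?coprimeXr 1?coprime_sym //.
    by rewrite -def_b mulnCA dvdn_mulr.
  by move: k_neq1 k_gt0; case: (k) => [|[|[|?]]] //= _ _ /dvdn_leq => /(_ isT).
rewrite (_ : (k == 2) = false) ?oppr0 //.
apply/eqP => k2; case: not_pow2; exists (Ordinal bnd) => /=.
by rewrite k2 mulnCA expnS.
Qed.

(** * Moebius inversion over powers of words *)

Lemma sum_mod_mul d p (G : nat -> nat) :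
  \sum_(0 <= i < d * p) G (i %% p)%N = (d * \sum_(0 <= j < p) G j)%N.
Proof.
elim: d => [|d IHd]; first by rewrite !mul0n big_nil.
rewrite !mulSn (@big_cat_nat _ _ _ p) ?leq_addr //=; congr (_ + _)%N.
  by apply: eq_big_nat => i /andP[_ i_lt]; rewrite modn_small.
rewrite -{1}[p]add0n big_addn addKn -IHd.
by apply: eq_bigr => i _; rewrite modnDr.
Qed.

Lemma period_mul m N (w : word m N) p k : period w p -> period w (k * p).
Proof.
move/forallP=> per; elim: k => [|k IHk].
  by apply/forallP => x; rewrite mul0n expg0 perm1.
apply/forallP => x; rewrite mulSn expgD permM.
by rewrite (eqP (forallP IHk _)); apply: per.
Qed.

Lemma period_mod m N (w : word m N) p i : (p <= m.+1)%N -> (0 < p)%N ->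
  period w p -> w i = w (inord (i %% p)).
Proof.
move=> p_le p_gt0 per; have r_lt : (i %% p < m.+1)%N by rewrite (leq_trans (ltn_pmod _ _)).
rewrite -(eqP (forallP (period_mul (i %/ p) per) (inord (i %% p)))).
congr (w _); apply: val_inj; rewrite /= shiftX inordK //.
by rewrite addnC -divn_eq modn_small.
Qed.

(** The power of [v] that has length [m.+1], when [p.+1] divides [m.+1]. *)
Definition unroll m p N (v : word p N) : word m N := [ffun i : 'I__ => v (inord (i %% p.+1))].

Lemma unrollE m p N (v : word p N) i : unroll m v i = v (inord (i %% p.+1)).
Proof. exact: ffunE. Qed.

Lemma packed_unroll m p N (v : word p N) : (p <= m)%N -> packed (unroll m v) = packed v.
Proof.
move=> pm.
have vE j : v j = unroll m v (inord j).
  by rewrite unrollE inordK ?modn_small ?inord_val // (leq_trans (ltn_ord j)).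
apply/'forall_forallP/'forall_forallP => pk i a; apply/implyP.
  rewrite vE => a_lt; have /existsP[j vj] := implyP (pk _ _) a_lt.
  by apply/existsP; exists (inord (j %% p.+1)); rewrite -unrollE.
rewrite unrollE => a_lt; have /existsP[j vj] := implyP (pk _ _) a_lt.
by apply/existsP; exists (inord j); rewrite -vE.
Qed.

Lemma weight_unroll (R : comNzRingType) (c : nat -> R) m p N d (v : word p N) :
  m.+1 = (d * p.+1)%N -> weight c (unroll m v) = weight (fun j => c (d * j)%N) v.
Proof.
move=> def_m; apply: eq_bigr => a _; congr c.
pose G j : nat := v (inord j) == a.
transitivity (\sum_(0 <= i < m.+1) G (i %% p.+1))%N.
  rewrite big_mkord -sum1_card big_mkcond; apply: eq_bigr => i _.
  by rewrite inE unrollE /G; case: eqP.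
rewrite def_m sum_mod_mul big_mkord -sum1_card [in RHS]big_mkcond; congr (_ * _)%N.
by apply: eq_bigr => i _; rewrite inE /G inord_val; case: eqP.
Qed.

Lemma sum_periodic (R : comNzRingType) (c : nat -> R) m p N d : (0 < d)%N ->
    m.+1 = (d * p.+1)%N ->
  \sum_(w : word m N | packed w && period w p.+1) weight c w
  = \sum_(v : word p N | packed v) weight (fun j => c (d * j)%N) v.
Proof.
move=> d_gt0 def_m.
have pm : (p.+1 <= m.+1)%N by rewrite def_m leq_pmull.
rewrite (reindex_onto (@unroll m p N) (fun w => [ffun i : 'I__ => w (inord i)])) /=.
  apply: eq_big => v; last by move=> _; apply: weight_unroll.
  rewrite packed_unroll // -andbA andb_idr // => _; apply/andP; split.
    apply/forallP => x; rewrite !unrollE shiftX.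
    by rewrite modn_dvdm ?modnDr // def_m dvdn_mull.
  apply/eqP/ffunP => i; rewrite ffunE unrollE inordK ?(leq_trans (ltn_ord i)) //.
  by rewrite modn_small // inord_val.
move=> w /andP[_ per]; apply/ffunP => i.
by rewrite unrollE ffunE inordK ?ltn_pmod // -period_mod.
Qed.

(** Periods are the multiples of the least one [q], so that the sum runs over the
    divisors of [n / q] and detects [q = n]. *)
Lemma sum_mobius_period m N (w : word m N) :
  \sum_(d <- divisors m.+1 | period w (m.+1 %/ d)) mobius d = (primitive w)%:R.
Proof.
have per_n : period w m.+1.
  by apply/forallP => x; rewrite shift_order perm1.
have ex_q : exists q, (0 < q)%N && period w q by exists m.+1.
case: (ex_minnP ex_q) => q /andP[q_gt0 per_q] q_min.
(* The remainder of a period modulo [q] is a period smaller than [q]. *)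
have perE p : period w p = (q %| p)%N.
  apply/idP/idP => [per_p|/dvdnP[k ->]]; last exact: period_mul.
  have per_r : period w (p %% q).
    apply/forallP => x; have /forallP/(_ x) := per_p.
    rewrite {1}(divn_eq p q) addnC expgD permM.
    by rewrite (eqP (forallP (period_mul _ per_q) _)).
  apply/negPn/negP; rewrite /dvdn -lt0n => r_gt0.
  by have := q_min (p %% q)%N; rewrite r_gt0 per_r leqNgt ltn_pmod // => /(_ isT).
have /dvdnP[e] : (q %| m.+1)%N by rewrite -perE.
rewrite mulnC => def_m.
have e_gt0 : (0 < e)%N by case: e def_m => //; rewrite muln0.
have -> : primitive w = (e == 1)%N.
  apply/forallP/eqP => [prim|e1 d]; last first.
    have qE : q = m.+1 by rewrite def_m e1 muln1.
    by apply/implyP => d_gt0; rewrite perE qE gtnNdvd.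
  apply/eqP; move: e_gt0; rewrite leq_eqVlt eq_sym => /orP[//|e_gt1].
  have q_lt : (q < m.+1)%N by rewrite def_m -[X in (X < _)%N]muln1 ltn_pmul2l.
  by have := prim (Ordinal q_lt); rewrite /= q_gt0 per_q.
rewrite -sum_mobius // -(big_divisors_cofactor _ q_gt0 e_gt0) -def_m.
rewrite big_seq_cond [RHS]big_seq_cond; apply: eq_bigl => d.
rewrite -dvdn_divisors //; apply: andb_id2l => d_n.
have d_gt0 : (0 < d)%N by apply: dvdn_gt0 d_n.
by rewrite perE -(dvdn_pmul2r d_gt0) divnK // def_m dvdn_pmul2l.
Qed.

Lemma sum_primitive_mobius (c : nat -> int) m N :
  \sum_(w : word m N | packed w && primitive w) weight c w
  = \sum_(d <- divisors m.+1) mobius d *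
      \sum_(v : word (m.+1 %/ d).-1 N | packed v) weight (fun j => c (d * j)%N) v.
Proof.
transitivity (\sum_(w : word m N | packed w)
   \sum_(d <- divisors m.+1 | period w (m.+1 %/ d)) mobius d * weight c w).
  rewrite big_mkcondr; apply: eq_bigr => w _ /=.
  by rewrite -mulr_suml sum_mobius_period; case: primitive; rewrite ?mul1r ?mul0r.
rewrite (exchange_big_dep predT) //=; apply: eq_big_seq => d.
rewrite -dvdn_divisors // => d_m; rewrite -mulr_sumr; congr (_ * _).
have d_gt0 : (0 < d)%N by apply: dvdn_gt0 d_m.
have p_gt0 : (0 < m.+1 %/ d)%N by rewrite divn_gt0 // dvdn_leq.
rewrite -(@sum_periodic _ c m) ?prednK //.
by rewrite mulnC divnK.
Qed.

(** * The three run weights *)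

(** The coefficients of the composition sum for runs of length at most 2:
    1 / (1 + x + x^2) = (1 - x) / (1 - x^3) = 1 - sum_(k > 0) chi3(k) x^k. *)
Definition chi3 (k : nat) : int := (k %% 3 == 1)%N%:R - (k %% 3 == 0)%N%:R.

(** Block weights after replacing [j] by [e * j]; the value 1 at 0 is the weight of
    a letter that does not occur. *)
Definition block (e j : nat) : int := if j == 0%N then 1 else chi3 (e * j)%N.

Lemma block_mod d j : (0 < d)%N -> block 1 (d * j)%N = block (d %% 3)%N j.
Proof.
by move=> d_gt0; rewrite /block muln_eq0 [d == 0%N]gtn_eqF // mul1n /chi3 modnMml.
Qed.

(** Convolutions are computed below by guessing their closed form [h], for which
    it suffices to check the recursion in [r]. *)
Lemma run_conv_unique (R : comNzRingType) (c v : nat -> R) (h : nat -> nat -> R) :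
    v 0 = 1 -> (forall k, h k.+1 0 = c k.+1) ->
    (forall k r, h k.+1 r.+1 = c k.+1 * v r.+1 + h k.+2 r) ->
  forall k r, run_conv c v k.+1 r = h k.+1 r.
Proof.
move=> v0 h0 hS k r; elim: r k => [|r IHr] k; last by rewrite run_convS IHr hS.
by rewrite /run_conv big_ord1 addn0 v0 mulr1 h0.
Qed.

Lemma chi3_sum3 k : chi3 k + chi3 k.+1 + chi3 k.+2 = 0.
Proof.
rewrite /chi3 -(addn2 k) -(addn1 k) -(modnDml k 1) -(modnDml k 2).
by case: (k %% 3)%N (ltn_pmod k (isT : 0 < 3)%N) => [|[|[|]]].
Qed.

Definition short_runs (r : nat) : int := (r <= 2)%N%:R.

Lemma short_runs_conv r : short_runs r.+1 = run_conv (block 1) short_runs 1 r.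
Proof.
pose h k r : int :=
  match r with 0 => chi3 k | 1 => chi3 k + chi3 k.+1 | _ => 0 end.
rewrite (@run_conv_unique _ _ _ h) //; first by case: r => [|[|r]].
  by move=> k; rewrite /block mul1n.
move=> k [|[|t]]; rewrite /= /block mul1n /short_runs /= ?mulr1 ?mulr0 ?addr0 //.
by rewrite addrA chi3_sum3.
Qed.

(** The run generating function 1 + x^2 / (1 - x) of runs of length at least 2,
    taken at [-x] to match [block 2]; the signs multiply to [(-1)^n]. *)
Definition long_runs (r : nat) : int := if r == 1%N then 0 else (-1) ^+ r.

Lemma long_runs_conv r : long_runs r.+1 = run_conv (block 2) long_runs 1 r.
Proof.
pose h k r : int :=
  if r is 0 then chi3 (2 * k)%N else (-1) ^+ r.+1 * chi3 (2 * k.+1)%N.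
have sum3 k : chi3 (2 * k)%N + chi3 (2 * k.+1)%N + chi3 (2 * k.+2)%N = 0.
  rewrite /chi3 -(addn2 k) -(addn1 k) -(modnMmr 2 k) -(modnMmr 2 (k + 1)).
  rewrite -(modnMmr 2 (k + 2)) -(modnDml k 1) -(modnDml k 2).
  by case: (k %% 3)%N (ltn_pmod k (isT : 0 < 3)%N) => [|[|[|]]].
rewrite (@run_conv_unique _ _ _ h) //.
  by case: r => [|r]; rewrite /h /long_runs //= mulr1.
move=> k [|t]; rewrite /h /= /block /long_runs /=.
  by rewrite mulr0 add0r expr2 mulrNN !mul1r.
rewrite [_ ^+ t.+3]exprS [_ ^+ t.+2]exprS.
have /eqP := sum3 k.+1; rewrite -[X in X == _]addrAC addr_eq0 => /eqP eq_tri.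
rewrite [chi3 _ * _]mulrC -mulrDr eq_tri; ring.
Qed.

(** Inverse of 1 + x / (1 - x), the case of constant block weights -1: the
    generating function is [1 - x], so that all runs must have length 1. *)
Definition unit_runs (r : nat) : int :=
  match r with 0 => 1 | 1 => -1 | _ => 0 end.

Lemma unit_runs_conv r : unit_runs r.+1 = run_conv (block 0) unit_runs 1 r.
Proof.
pose h (k r : nat) : int := if r is 0 then -1 else 0.
rewrite (@run_conv_unique _ _ _ h) //.
by move=> k [|[|t]]; rewrite /= /block mul0n.
Qed.

(** Two consecutive uncut positions would make a run of length 3; [true] as the
    bit before the sequence starts a fresh run. *)
Lemma runprod_short b : runprod short_runs 1 b = (path orb true b)%:R.
Proof.
have aux k : runprod short_runs k.+1 b
    = if k is 0 then (path orb true b)%:R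
      else if k is 1 then (path orb false b)%:R else 0.
  elim: b k => [|[] b IHb] [|[|k]] //=; rewrite ?IHb ?mul1r ?mul0r //=.
exact: (aux 0%N).
Qed.

(** A run of length 1 shows up as two consecutive cuts, or as a cut in first or in
    last place.  The initial [true] acts as a cut before the first position, which
    also excludes the empty sequence, that is [n = 1]. *)
Lemma runprod_long b : runprod long_runs 1 b
  = (-1) ^+ (size b).+1 * (path (fun x y => ~~ (x && y)) true b && ~~ last true b)%:R.
Proof.
pose nand x y := ~~ (x && y).
have aux k : runprod long_runs k.+1 b
    = (-1) ^+ (k + size b).+1 *
      (if k is 0 then path nand true b && ~~ last true b
       else path nand false b && ~~ last false b)%:R.
  elim: b k => [|[] b IHb] [|k] //=; rewrite ?addn0 ?mulr0 ?mul0r ?mulr1 //.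
    by rewrite IHb mulrA -exprD; congr (_ ^+ _ * _); rewrite addSnnS.
  by rewrite IHb -addSnnS.
exact: (aux 0%N).
Qed.

Lemma runprod_unit b : runprod unit_runs 1 b = (-1) ^+ (size b).+1 * (all id b)%:R.
Proof.
have aux k : runprod unit_runs k.+1 b
    = if k is 0 then (-1) ^+ (size b).+1 * (all id b)%:R else 0.
  elim: b k => [|[] b IHb] [|k] //=; rewrite ?IHb ?mul0r ?mulr0 //=.
  by rewrite mulrA -exprS.
exact: (aux 0%N).
Qed.

Lemma path_descents m (p : 'S_m.+1) (e : rel bool) x0 :
  (forall y, e x0 y) ->
  path e x0 (descents p)
  = [forall i : 'I_m.+1, (i.+1 < m)%N ==> e (descent p i) (descent p i.+1)].
Proof.
move=> e_x0.
have -> : path e x0 (descents p) = sorted e (descents p).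
  by case: (descents p) => //= y s; rewrite e_x0.
have nth_des i : (i < m)%N -> nth false (descents p) i = descent p i.
  by move=> i_lt; rewrite nth_mkseq.
apply/(sortedP false)/forallP => [H i|H i]; rewrite ?size_descents.
  apply/implyP => i_lt; have := H i; rewrite size_descents => /(_ i_lt).
  by rewrite (nth_des _ i_lt) (nth_des _ (ltnW i_lt)).
move=> i_lt; have i_lt' : (i < m.+1)%N by apply/leqW/ltnW.
have /implyP/(_ i_lt) := H (Ordinal i_lt').
by rewrite (nth_des _ i_lt) (nth_des _ (ltnW i_lt)).
Qed.

Lemma avoids_123E m (p : 'S_m.+1) : avoids_123 p = path orb true (descents p).
Proof.
rewrite path_descents //; apply: eq_forallb => i; rewrite !ascentE.
have [i_lt|] := ltnP i.+1 m; last by rewrite /= andbF.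
by rewrite (ltnW i_lt) /= -negb_or negbK.
Qed.

Lemma avoids_321E m (p : 'S_m.+1) :
  avoids_321 p = path (fun x y => ~~ (x && y)) false (descents p).
Proof.
rewrite path_descents //; apply: eq_forallb => i.
have [//|m_le] := ltnP i.+1 m.
suff -> : descent p i.+1 = false by rewrite andbF.
apply/existsP => -[x /existsP[y /and3P[/eqP xi /eqP yi _]]].
by have := ltn_ord y; rewrite /= yi ltnS ltnNge m_le.
Qed.

Lemma sum_short m :
  \sum_(s : 'S_m.+1) runprod short_runs 1 (descents s) = (gamma m.+1)%:R.
Proof.
rewrite /gamma -sum1_card natr_sum [RHS]big_mkcond; apply: eq_bigr => s _.
by rewrite runprod_short -avoids_123E inE; case: avoids_123.
Qed.

Lemma sum_long m :
  \sum_(s : 'S_m.+1) runprod long_runs 1 (descents s)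
  = (-1) ^+ m.+1 * (gamma_star m.+1)%:R.
Proof.
pose star (s : 'S_m.+1) := path (fun x y => ~~ (x && y)) true (descents s)
                           && ~~ last true (descents s).
transitivity ((-1) ^+ m.+1 * #|[set s | star s]|%:R : int).
  rewrite -sum1_card natr_sum mulr_sumr [RHS]big_mkcond; apply: eq_bigr => s _.
  rewrite runprod_long size_descents inE -/(star s).
  by case: star; rewrite ?mulr1 ?mulr0.
congr (_ * _%:R); case: m @star => [|m] star /=.
  by apply: eq_card0 => s; rewrite inE.
apply: eq_card => s; rewrite !inE /star.
have -> : last true (descents s) = descent s m.
  by rewrite -nth_last size_descents nth_mkseq.
rewrite avoids_321E !ascentE ltnSn /=.
by case: (descent s 0); rewrite /= ?andbF.
Qed.

(** Only the decreasing permutation has all runs of length 1; it is the unique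
    permutation that sorts the positions from right to left. *)
Lemma sum_unit m :
  \sum_(s : 'S_m.+1) runprod unit_runs 1 (descents s) = (-1) ^+ m.+1.
Proof.
pose key (i : 'I_m.+1) := (m - i)%N.
have key_inj : injective key.
  by move=> i j; rewrite /key => eq_ij; apply: val_inj => /=;
     have := ltn_ord i; have := ltn_ord j; lia.
have decrE (s : 'S_m.+1) : all id (descents s) = sorts key s.
  apply/idP/idP => [/(all_nthP false) des|]; last first.
    move=> s_key; apply/(all_nthP false) => i; rewrite size_descents => i_lt.
    rewrite nth_mkseq // descentE // (sorts_lt _ _ s_key) /key !inordK ?ltnS //.
      by lia.
    exact: ltnW.
  have decr (i j : 'I_m.+1) : (i < j)%N -> (s j < s i)%N.
    case: j => j j_lt /=; elim: j j_lt => // j IHj j_lt.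
    have j_lt' : (j < m.+1)%N by apply: ltnW.
    have sS : (s (Ordinal j_lt) < s (Ordinal j_lt'))%N.
      have := des j; rewrite size_descents nth_mkseq // descentE // => /(_ j_lt).
      have -> : inord j = Ordinal j_lt' by apply: val_inj; rewrite /= inordK.
      by have -> : inord j.+1 = Ordinal j_lt by apply: val_inj; rewrite /= inordK.
    rewrite ltnS leq_eqVlt => /predU1P[ij|ij].
      by rewrite (_ : i = Ordinal j_lt') //; apply: val_inj.
    exact: ltn_trans sS (IHj j_lt' ij).
  apply/sortsP => i j sij; rewrite /key.
  case: (ltngtP i j) => [/decr|ji|/val_inj eq_ij]; first by rewrite ltnNge ltnW.
    by have := ltn_ord i; lia.
  by move: sij; rewrite eq_ij ltnn.
have [s0 s0_key] := sorts_exists key_inj.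
rewrite (bigD1 s0) //= runprod_unit decrE s0_key size_descents mulr1.
rewrite big1 ?addr0 // => s s_neq; rewrite runprod_unit decrE.
suff /negPf -> : ~~ sorts key s by rewrite mulr0.
by apply: contraNN s_neq => s_key; rewrite (sorts_uniq s_key s0_key).
Qed.

Lemma sum_packed_block m N d : (0 < d)%N -> (m <= N)%N ->
  \sum_(v : word m N | packed v) weight (fun j => block 1 (d * j)%N) v
  = if (d %% 3 == 1)%N then (gamma m.+1)%:R
    else if (d %% 3 == 2)%N then (-1) ^+ m.+1 * (gamma_star m.+1)%:R
    else (-1) ^+ m.+1.
Proof.
move=> d_gt0 mN.
transitivity (\sum_(v : word m N | packed v) weight (block (d %% 3)) v).
  by apply: eq_bigr => v _; apply: eq_bigr => a _; apply: block_mod.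
case: (d %% 3)%N (ltn_pmod d (isT : 0 < 3)%N) => [|[|[|]]] //= _.
- by rewrite (sum_packed_runs _ _ unit_runs_conv) // sum_unit.
- by rewrite (sum_packed_runs _ _ short_runs_conv) // sum_short.
by rewrite (sum_packed_runs _ _ long_runs_conv) // sum_long.
Qed.

(** * Cycles without two consecutive ascents *)

Lemma full_cycles_avoiding_123 n : (0 < n)%N ->
  n%:R * #|[set s : 'S_n | is_full_cycle s && avoids_123 s]|%:R
  = theta n
    + \sum_(d <- divisors n | (d %% 3 == 1)%N) mobius d * (gamma (n %/ d))%:R
    + \sum_(d <- divisors n | (d %% 3 == 2)%N)
        mobius d * (-1) ^+ (n %/ d) * (gamma_star (n %/ d))%:R :> int.
Proof.
case: n => // m _.
transitivity (\sum_(w : word m m | packed w && primitive w) weight (block 1) w).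
  rewrite (sum_primitive_runs _ _ short_runs_conv) //; congr (_ * _).
  rewrite -sum1_card natr_sum big_mkcond [RHS]big_mkcond; apply: eq_bigr => s _.
  by rewrite inE runprod_short -avoids_123E; case: is_full_cycle; case: avoids_123.
rewrite sum_primitive_mobius thetaE //.
rewrite [X in X + _ + _]big_mkcond [X in _ + X + _]big_mkcond [X in _ + X]big_mkcond.
rewrite -!big_split /=; apply: eq_big_seq => d.
rewrite -dvdn_divisors // => d_m; have d_gt0 : (0 < d)%N by apply: dvdn_gt0 d_m.
have p_gt0 : (0 < m.+1 %/ d)%N by rewrite divn_gt0 // dvdn_leq.
rewrite sum_packed_block //; last by rewrite -ltnS prednK // leq_div.
rewrite prednK // /dvdn; case: (d %% 3)%N (ltn_pmod d (isT : 0 < 3)%N) => [|[|[|]]] //= _.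
- by rewrite !addr0.
- by rewrite add0r addr0.
by rewrite !add0r mulrA.
Qed.

Theorem theorem6p7 (n : nat) (n_ge1 : (1 <= n)%N) :
  (#|[set s : 'S_n | is_full_cycle s && avoids_123 s]|%:R : rat) =
    1 / n%:R *
      ((theta n)%:~R
       + \sum_(d <- divisors n | (d %% 3 == 1)%N)
           (mobius d)%:~R * (gamma (n %/ d)%N)%:R
       + \sum_(d <- divisors n | (d %% 3 == 2)%N)
           (mobius d)%:~R * (-1) ^+ (n %/ d)%N * (gamma_star (n %/ d)%N)%:R).
Proof.
have n_neq0 : n%:R != 0 :> rat by rewrite Num.Theory.pnatr_eq0 -lt0n.
apply: (mulfI n_neq0); rewrite mul1r mulrA divff // mul1r.
have /(congr1 (fun z : int => z%:~R : rat)) := full_cycles_avoiding_123 n_ge1.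
rewrite rmorphM /= !rmorph_nat !rmorphD /= !rmorph_sum /= => ->.
congr (_ + _ + _); apply: eq_bigr => d _; rewrite !rmorphM /= ?rmorph_nat //.
by rewrite rmorphXn /= rmorphN1.
Qed.
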